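(* Let $m\ge 1$ be an integer, let $O_{m+1}$ be the Odd graph with vertex set $X=\binom{\Omega}{m}$, $|\Omega|=2m+1$, fix $x\in X$, and let $\mathcal{T}=\mathcal{T}(x)$ be the Terwilliger algebra of $O_{m+1}$ with respect to $x$. Then the matrices $$L\bigl(H_{m-i,m-j}^l(m)\otimes H_{i,j}^s(m+1)\bigr),\qquad 0\le i,j\le m,\quad l\in G_{m-i,m-j}(m),\quad s\in G_{i,j}(m+1),$$ form a basis of the complex vector space $\mathcal{T}$.
   Context: Odd graph. $\Omega$ is a set with $|\Omega|=2m+1$, and $\binom{\Omega}{i}$ is the set of $i$-subsets of $\Omega$. The Odd graph $O_{m+1}$ has vertex set $X=\binom{\Omega}{m}$, two vertices being adjacent iff they are disjoint. It is connected with diameter $m$. Let $A\in\mathrm{Mat}_X(\mathbb{C})$ be its adjacency matrix, $\partial$ its distance function and $\Gamma_i(x)=\{y\in X: \partial(x,y)=i\}$. Terwilliger algebra. For $0\le i\le m$, $E_i^*=E_i^*(x)$ is the diagonal matrix in $\mathrm{Mat}_X(\mathbb{C})$ with $(y,y)$-entry $1$ if $y\in\Gamma_i(x)$ and $0$ otherwise. $\mathcal{T}(x)$ is the subalgebra of $\mathrm{Mat}_X(\mathbb{C})$ generated by $A,E_0^*,\dots,E_m^*$. Intersection matrices. For a set $V$ with $|V|=v$, $H_{i,j}^l(v)$ is the 0-1 matrix with rows indexed by $\binom{V}{i}$ and columns indexed by $\binom{V}{j}$, whose $(y,z)$-entry is $1$ iff $|y\cap z|=l$. Put $G_{i,j}(v)=\{g\in\mathbb{Z}: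 \max(0,i+j-v)\le g\le \min(i,j)\}$. In the Kronecker product $H_{m-i,m-j}^l(m)\otimes H_{i,j}^s(m+1)$ the first factor is taken with $V=x$ and the second with $V=\Omega\setminus x$; its rows, indexed by pairs $(\alpha,\beta)\in\binom{x}{m-i}\times\binom{\Omega\setminus x}{i}$, are identified with the vertices $y=\alpha\cup\beta$, i.e. with the $y\in X$ such that $|x\cap y|=m-i$, and similarly its columns with the $z\in X$ such that $|x\cap z|=m-j$. (Each set $\{y\in X:|x\cap y|=m-i\}$, $0\le i\le m$, is one of the sets $\Gamma_p(x)$: it equals $\Gamma_{2i}(x)$ if $2i\le m$ and $\Gamma_{2(m-i)+1}(x)$ otherwise.) Embedding $L$. For a matrix $M$ with rows indexed by $\Gamma_p(x)$ and columns by $\Gamma_q(x)$, $L(M)\in\mathrm{Mat}_X(\mathbb{C})$ is the matrix whose $\Gamma_p(x)\times\Gamma_q(x)$ block is $M$ and whose other entries are $0$. *)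

(* Defs.v *)
From HB Require Import structures.
From mathcomp Require Import all_boot all_order all_algebra falgebra.
From mathcomp Require Import reals.
From mathcomp Require Import complex mxtens.

Set Implicit Arguments.
Unset Strict Implicit.
Unset Printing Implicit Defensive.

Import GRing.Theory.
Local Open Scope ring_scope.

(* Mat_V(F) for a nonempty finite type V is represented by square matrices of
   size #|V|.-1.+1: this is #|V|, written as a successor because only matrices
   of size n.+1 carry the falgType structure needed for generated subalgebras.
   A point x0 of V witnesses #|V| > 0; [vidx] and [vval] are the resulting
   mutually inverse bijections, and do not depend on the choice of x0. *)
Notation "''Mat[' F ]_ V" := 'M[F]_(#|V|.-1.+1)
  (at level 8, V at level 2, format "''Mat[' F ]_ V") : type_scope.

Lemma card_inhab (V : finType) (x0 : V) : (0 < #|V|)%N.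
Proof. by apply/card_gt0P; exists x0. Qed.

Definition vidx (V : finType) (x0 y : V) : 'I_(#|V|.-1.+1) :=
  cast_ord (esym (prednK (card_inhab x0))) (enum_rank y).

Definition vval (V : finType) (x0 : V) (a : 'I_(#|V|.-1.+1)) : V :=
  enum_val (cast_ord (prednK (card_inhab x0)) a).

Lemma vidxK (V : finType) (x0 : V) : cancel (vidx x0) (vval x0).
Proof. by move=> y; rewrite /vval /vidx cast_ordKV enum_rankK. Qed.

Lemma vvalK (V : finType) (x0 : V) : cancel (vval x0) (vidx x0).
Proof. by move=> a; rewrite /vval /vidx enum_valK cast_ordK. Qed.

Definition has_walk (V : finType) (e : rel V) (k : nat) (x y : V) : bool :=
  [exists p : k.-tuple V, path e x p && (last x p == y)].

(* Least length of a walk from x to y. A shortest walk has length < #|V|; the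
   value is #|V| when there is no walk at all. *)
Definition gdist (V : finType) (e : rel V) (x y : V) : nat :=
  find (fun k => has_walk e k x y) (iota 0 #|V|).

Definition sphere (V : finType) (e : rel V) (i : nat) (x : V) : {set V} :=
  [set y | gdist e x y == i].

Definition adj_mx (F : fieldType) (V : finType) (e : rel V) (x0 : V)
  : 'Mat[F]_V :=
  \matrix_(a, b) (e (vval x0 a) (vval x0 b))%:R.

Definition dual_idempotent (F : fieldType) (V : finType) (e : rel V) (x : V)
    (i : nat) : 'Mat[F]_V :=
  \matrix_(a, b) ((a == b) && (vval x a \in sphere e i x))%:R.

(* D is the diameter of the graph. *)
Definition terwilliger (F : fieldType) (V : finType) (e : rel V) (D : nat)
    (x : V) : {vspace 'Mat[F]_V} :=
  agenv <<adj_mx F e x :: [seq dual_idempotent F e x i | i <- iota 0 D.+1]>>%VS.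

(* L : the block M in position sphere p x, sphere q x, and 0 elsewhere. *)
Definition embed_block (F : fieldType) (V : finType) (e : rel V) (x : V)
    (p q : nat) (M : 'M[F]_(#|sphere e p x|, #|sphere e q x|)) : 'Mat[F]_V :=
  \sum_a \sum_b M a b *: delta_mx (vidx x (enum_val a)) (vidx x (enum_val b)).

Definition ksubsets (T : finType) (V : {set T}) (k : nat) : {set {set T}} :=
  [set y : {set T} | (y \subset V) && (#|y| == k)].

Definition odd_vertex (T : finType) (m : nat) : finType :=
  {y : {set T} | #|y| == m}.

Definition odd_adj (T : finType) (m : nat) : rel (odd_vertex T m) :=
  fun y z => [disjoint val y & val z].

Definition Hmx (F : fieldType) (T : finType) (V : {set T}) (i j l : nat)
  : 'M[F]_(#|ksubsets V i|, #|ksubsets V j|) :=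
  \matrix_(a, b) (#|enum_val a :&: enum_val b| == l)%:R.

(* On nat, i + j - v is max(0, i + j - v). *)
Definition Grange (i j v : nat) : seq nat :=
  [seq g <- iota 0 (minn i j).+1 | (i + j - v <= g)%N].

(* {y : |x :&: y| = m - i} is the sphere of this radius around x. *)
Definition radius (m i : nat) : nat :=
  if (2 * i <= m)%N then (2 * i)%N else (2 * (m - i)).+1.

(* The set alpha :|: beta named by the row (alpha, beta) of a Kronecker product. *)
Definition pair_union (T : finType) (V W : {set T}) (k l : nat)
    (r : 'I_(#|ksubsets V k| * #|ksubsets W l|)) : {set T} :=
  enum_val (mxtens_unindex r).1 :|: enum_val (mxtens_unindex r).2.

(* H^l_{m-i,m-j}(m) (x) H^s_{i,j}(m+1), with rows and columns relabelled by the
   vertices alpha :|: beta. For i, j <= m and #|T| = 2m+1 every vertex of the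
   sphere is the union of exactly one pair, so each sum has a single term. *)
Definition Hblock (F : fieldType) (T : finType) (m : nat) (x : odd_vertex T m)
    (i j l s : nat)
  : 'M[F]_(#|sphere (@odd_adj T m) (radius m i) x|,
           #|sphere (@odd_adj T m) (radius m j) x|) :=
  let K := tensmx (Hmx F (val x) (m - i) (m - j) l) (Hmx F (~: val x) i j s) in
  \matrix_(a, b)
    \sum_(r | pair_union r == val (enum_val a))
    \sum_(c | pair_union c == val (enum_val b)) K r c.

(* L(H^l_{m-i,m-j}(m) (x) H^s_{i,j}(m+1)) *)
Definition LH (F : fieldType) (T : finType) (m : nat) (x : odd_vertex T m)
    (i j l s : nat) : 'Mat[F]_(odd_vertex T m) :=
  embed_block (Hblock F x i j l s).

(* The quadruples (i, j, l, s), as pairs ((i, j), (l, s)). *)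
Definition LH_indices (m : nat) : seq ((nat * nat) * (nat * nat)) :=
  [seq (ij, ls)
     | ij <- [seq (i, j) | i <- iota 0 m.+1, j <- iota 0 m.+1],
       ls <- [seq (l, s) | l <- Grange (m - ij.1) (m - ij.2) m,
                           s <- Grange ij.1 ij.2 m.+1]].

(* Main.v *)
Require Import Defs.
From mathcomp Require Import all_boot all_order all_algebra falgebra.
From mathcomp Require Import perm zify.
From mathcomp Require Import reals.
From mathcomp Require Import complex mxtens.

Set Implicit Arguments.
Unset Strict Implicit.
Unset Printing Implicit Defensive.

Import GRing.Theory Num.Theory.
Local Open Scope nat_scope.

(** Put outer(y, z) = |(y :&: z) :\: x| and inner(y, z) = |x :&: y :&: z|.
The type of a pair of vertices is (outer(y, y), outer(z, z)),
(inner(y, z), outer(y, z)); two pairs have the same type exactly when a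
permutation of the ground set that fixes x carries one to the other, and the
types that occur are the admissible quadruples (i, j, l, s). The matrices of
the statement are therefore the 0/1 matrices of these orbits of pairs
([LH_orbital_mx]). They are nonzero with disjoint supports, hence free
([orbital_free]), and they span the space of matrices whose entries depend
only on the type ([orbital_spaceP]). That space is closed under products,
because any two pairs of equal type are related by an automorphism
([pair_type_transitive]). The distance from x to y being a function of
outer(y, y) ([gdist_base]), the generators of the Terwilliger algebra belong
to it, which gives one inclusion.

For the other inclusion, every orbit matrix must be obtained from A and the
dual idempotents. Expand a product of two 0/1 matrices of the algebra in orbit
matrices: the coefficients count paths, and those of the orbits reached are
nonzero since the characteristic is 0. So if all orbits reached but one are
known to lie in the algebra, the last one lies in it too
([orbital_of_product]). This is used twice.

- If |y :&: z| = m - 1, then y and z have a common neighbour v, the complement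
of y :|: z. Take the paths through vertices on the sphere of v between the
spheres of y and z. Inclusion-exclusion inside x and inside its complement
bounds the overlaps of their ends below by those of y and z, so that such a path
joins two vertices with the type of (y, z), or returns to its origin
([orbital_edge]). The sphere of v records |(y :|: z) :\: x|, which is what
separates the pairs that differ inside x from those that differ outside.

- In general, descend on |y :&: z|. Exchange one point of z :\: y for one of
y :\: z to get u; the type of (y, u) is known by induction and that of (u, z)
by the first case. By the triangle inequality, in x and in its complement,
their product only reaches the type of (y, z) and types with more overlap
([orbital_in_terw]). *)

(** * Colourings and cardinals of overlaps *)

Lemma card_indicator (T : finType) (A : {set T}) : #|A| = \sum_t (t \in A).
Proof. by rewrite -sum1_card big_mkcond; apply: eq_bigr => t _; case: ifP. Qed.

(** The sequences of values of the two colourings are rearrangements of each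
other. *)
Lemma colouring_perm (T : finType) (K : eqType) (c c' : T -> K) :
    (forall k, #|[set t | c t == k]| = #|[set t | c' t == k]|) ->
  exists2 p : T -> T, injective p & forall t, c' (p t) = c t.
Proof.
move=> eq_fibres.
have cnt (d : T -> K) k : count_mem k (codom_tuple d) = #|[set t | d t == k]|.
  by rewrite /= codomE count_map cardsE cardE size_filter enumT.
have : perm_eq (codom_tuple c) (codom_tuple c').
  by apply/allP => k _ /=; apply/eqP; rewrite !cnt.
case/tuple_permP => s eq_c.
exists (fun t => enum_val (s (enum_rank t))).
  by move=> t t' /enum_val_inj /perm_inj /enum_rank_inj.
move=> t; have := congr1 (fun w => nth (c t) w (enum_rank t)) eq_c.
by rewrite [LHS]nth_codom -tnth_nth tnth_mktuple (tnth_nth (c t)) /= nth_codom enum_rankK.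
Qed.

Section Overlaps.

Variable T : finType.
Implicit Types S x y z u v : {set T}.

Definition overlap S y z := #|S :&: (y :&: z)|.

Lemma overlapC S y z : overlap S y z = overlap S z y.
Proof. by rewrite /overlap (setIC y). Qed.

Lemma overlap_le S y z : overlap S y z <= overlap S y y.
Proof. by rewrite subset_leq_card // setIid setIS // subsetIl. Qed.

Lemma overlap_disjoint S y z : [disjoint y & z] -> overlap S y z = 0.
Proof. by move=> /disjoint_setI0 e; rewrite /overlap e setI0 cards0. Qed.

Lemma overlap_split x y z : overlap x y z + overlap (~: x) y z = #|y :&: z|.
Proof.
by rewrite /overlap -(cardsID x (y :&: z)) setDE !(setIC (y :&: z)).
Qed.

(** Inside S, the points of u outside y and the points of u outside z are all
that the points of u may lose before lying in both y and z. *)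
Lemma overlap_triangle S y u z :
  overlap S y u + overlap S u z <= overlap S u u + overlap S y z.
Proof.
rewrite /overlap !card_indicator -!big_split /=; apply: leq_sum => t _.
by rewrite !inE; do !case: (t \in _).
Qed.

(** A truncation of inclusion-exclusion: a point lying in all three sets is
counted with excess on the right. *)
Lemma overlap_cover S y u z :
  overlap S y y + overlap S u u + overlap S z z <=
  #|S| + (overlap S y u + overlap S u z + overlap S y z).
Proof.
rewrite /overlap !card_indicator -!big_split /=; apply: leq_sum => t _.
by rewrite !inE; do !case: (t \in _).
Qed.

Lemma overlap_compl S y z :
  overlap S (~: (y :|: z)) (~: (y :|: z)) + overlap S y y + overlap S z z
  = #|S| + overlap S y z.
Proof.
rewrite /overlap !card_indicator -!big_split /=; apply: eq_bigr => t _.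
by rewrite !inE; do !case: (t \in _).
Qed.

(** Used with a in y :\: z and b in z :\: y, when it is a step from z towards y;
the lemmas below follow this step inside x and inside its complement. *)
Definition swap z a b := a |: z :\ b.

Lemma card_setI1 S a : (a \in S) = #|S :&: [set a]| :> nat.
Proof.
case aS: (a \in S); first by rewrite (setIidPr _) ?cards1 // sub1set.
by apply/esym/eqP; rewrite cards_eq0 setIC setI_eq0 disjoints1 aS.
Qed.

Section Swap.
Variables (S y z : {set T}) (a b : T).
Hypotheses (ay : a \in y) (az : a \notin z) (bz : b \in z) (by_ : b \notin y).

Lemma overlap_swapl : overlap S y (swap z a b) = overlap S y z + (a \in S).
Proof.
rewrite card_setI1 /overlap !card_indicator -!big_split /=.
apply: eq_bigr => t _; rewrite !inE.
have [->|_] := eqVneq t a; first by rewrite ay (negPf az); case: (a \in S).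
have [->|_] := eqVneq t b; first by rewrite (negPf by_) !andbF.
by rewrite andbF addn0.
Qed.

Lemma overlap_swapr : overlap S (swap z a b) z + (b \in S) = overlap S z z.
Proof.
rewrite card_setI1 /overlap !card_indicator -!big_split /=.
apply: eq_bigr => t _; rewrite !inE.
have [->|_] := eqVneq t a.
  rewrite (negPf az) !andbF.
  by have [e|_] := eqVneq a b; rewrite ?andbF //; case/negP: az; rewrite e.
by have [->|_] := eqVneq t b; rewrite ?bz; do !case: (_ \in _).
Qed.

Lemma overlap_swap :
  overlap S (swap z a b) (swap z a b) + (b \in S) = overlap S z z + (a \in S).
Proof.
rewrite !card_setI1 /overlap !card_indicator -!big_split /=.
apply: eq_bigr => t _; rewrite !inE.
have [->|_] := eqVneq t a.
  rewrite (negPf az) !andbF.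
  by have [e|_] := eqVneq a b; [case/negP: az; rewrite e | case: (_ \in _)].
by have [->|_] := eqVneq t b; rewrite ?bz; do !case: (_ \in _).
Qed.

End Swap.

Lemma card_swap z a b : a \notin z -> b \in z -> #|swap z a b| = #|z|.
Proof.
move=> az bz; rewrite cardsU1 (cardsD1 b z) bz !inE (negPf az) andbF.
by [].
Qed.

(** The overlaps in x and in its complement determine, by inclusion-exclusion,
the sizes of the eight cells of the Venn diagram of x, y and z. *)
Lemma same_overlaps_perm x y z y' z' :
    (forall S, S = x \/ S = ~: x ->
       [/\ overlap S y y = overlap S y' y', overlap S z z = overlap S z' z'
         & overlap S y z = overlap S y' z']) ->
  exists2 p : T -> T, injective p &
    forall t, [/\ (p t \in x) = (t \in x), (p t \in y') = (t \in y)
                & (p t \in z') = (t \in z)].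
Proof.
move=> eq_ov.
pose col (u v : {set T}) t := (t \in x, (t \in u, t \in v)).
pose cell S u v b c := #|[set t in S | ((t \in u) == b) && ((t \in v) == c)]|.
have cellE S u v : [/\ cell S u v true true = overlap S u v,
    cell S u v true false + overlap S u v = overlap S u u,
    cell S u v false true + overlap S u v = overlap S v v &
    cell S u v false false + overlap S u u + overlap S v v
      = #|S| + overlap S u v].
  split; rewrite /cell /overlap !card_indicator -?big_split /=;
  by apply: eq_bigr => t _; rewrite !inE; do !case: (t \in _).
have eq_cell S b c : S = x \/ S = ~: x -> cell S y z b c = cell S y' z' b c.
  move=> /eq_ov[]; have [? ? ? ?] := cellE S y z.
  by have [? ? ? ?] := cellE S y' z'; case: b; case: c; lia.
have colE u v k b c : #|[set t | col u v t == (k, (b, c))]|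
    = cell (if k then x else ~: x) u v b c.
  apply: eq_card => t; rewrite !inE !xpair_eqE.
  by case: k; rewrite ?inE; do !case: (t \in _).
have [|p p_inj colp] := @colouring_perm _ _ (col y z) (col y' z').
  move=> [k [b c]]; rewrite !colE; apply: eq_cell.
  by case: k; [left | right].
by exists p => // t; case: (colp t).
Qed.

Lemma imset_preim_eq (p : T -> T) (A B : {set T}) :
  injective p -> #|A| = #|B| -> (forall t, (p t \in B) = (t \in A)) ->
  p @: A = B.
Proof.
move=> p_inj cAB pAB; apply/eqP.
rewrite eqEcard card_imset // cAB leqnn andbT.
by apply/subsetP => _ /imsetP[t tA ->]; rewrite pAB.
Qed.

Lemma overlap_imset (p : T -> T) S y z : injective p ->
  (forall t, (p t \in S) = (t \in S)) ->
  overlap S (p @: y) (p @: z) = overlap S y z.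
Proof.
move=> p_inj pS; have {1}<- : p @: S = S by exact: imset_preim_eq.
by rewrite /overlap -!imsetI ?card_imset //; apply: in2W.
Qed.

Lemma subset_card (A : {set T}) k : (k <= #|A|)%N ->
  exists2 B : {set T}, B \subset A & #|B| = k.
Proof.
move=> lekA; have := bin_gt0 #|A| k; rewrite lekA -cards_draws.
by case/card_gt0P => B; rewrite inE => /andP[sBA /eqP cB]; exists B.
Qed.

(** Take l common points, then complete the second set outside the first. *)
Lemma subsets_meeting (V : {set T}) i j l : l \in Grange i j #|V| ->
  exists A B : {set T},
    [/\ A \subset V, B \subset V, #|A| = i, #|B| = j & #|A :&: B| = l].
Proof.
rewrite mem_filter mem_iota => Gl.
have [|A sAV cA] := @subset_card V i; first by lia.
have [|C sCA cC] := @subset_card A l; first by lia.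
have cVA : (#|V :\: A| + i = #|V|)%N.
  by rewrite -cA -(cardsID A V) (setIidPr sAV) addnC.
have [|D sD cD] := @subset_card (V :\: A) (j - l); first by lia.
have dAD : A :&: D = set0.
  apply/setP => t; rewrite !inE; apply/negP => /andP[tA /(subsetP sD)].
  by rewrite inE tA.
have eAB : A :&: (C :|: D) = C by rewrite setIUr dAD setU0 (setIidPr sCA).
exists A, (C :|: D); split; rewrite ?eAB //.
  by rewrite subUset (subset_trans sCA sAV) (subset_trans sD) ?subsetDl.
have := cardsUI C D; suff -> : C :&: D = set0 by rewrite cards0; lia.
by apply/eqP; rewrite -subset0 -dAD setSI.
Qed.

End Overlaps.

(** * Distances in the Odd graph *)

Section Distance.

Lemma gdist_least (V : finType) (e : rel V) (y z : V) k :
    (k < #|V|)%N -> has_walk e k y z ->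
    (forall k', (k' < k)%N -> ~~ has_walk e k' y z) ->
  gdist e y z = k.
Proof.
move=> ltkV wk min_k; rewrite /gdist -(subnKC (ltnW ltkV)) iotaD find_cat.
case: hasP => [[k']|_].
  by rewrite mem_iota add0n => /andP[_ ltk'k] /(negP (min_k _ ltk'k)).
rewrite size_iota; case: (_ - _)%N (subn_gt0 k #|V|) => [|d _]; first by rewrite ltkV.
by rewrite /= add0n wk addn0.
Qed.

Lemma has_walkP (V : finType) (e : rel V) k (y z : V) :
  reflect (exists p : seq V, [/\ size p = k, path e y p & last y p = z])
          (has_walk e k y z).
Proof.
apply: (iffP existsP) => [[p /andP[py /eqP lp]]|[p [/eqP sp py lp]]].
  by exists p; rewrite size_tuple.
by exists (Tuple sp); rewrite /= py lp eqxx.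
Qed.

Lemma has_walk_rcons (V : finType) (e : rel V) k (y u z : V) :
  has_walk e k y u -> e u z -> has_walk e k.+1 y z.
Proof.
move=> /has_walkP[p [sp py lp]] euz; apply/has_walkP; exists (rcons p z).
by rewrite size_rcons sp rcons_path py lp euz last_rcons.
Qed.

End Distance.

(** A name for the underlying set of a vertex, so that all occurrences go
through one and the same projection, which simplification leaves alone. *)
Definition vset (T : finType) m (y : odd_vertex T m) : {set T} := val y.
Arguments vset : simpl never.

Lemma vset_inj (T : finType) m : injective (@vset T m).
Proof. exact: val_inj. Qed.

Section OddGraph.

Variables (T : finType) (m : nat).
Hypothesis card_T : #|T| = (2 * m).+1.

Local Notation X := (odd_vertex T m).
Local Notation adj := (@odd_adj T m).
Implicit Types x y z u v : X.

Lemma card_vertex y : #|vset y| = m.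
Proof. exact/eqP/(valP y). Qed.

Lemma vertex_of (A : {set T}) : #|A| = m -> exists u : X, vset u = A.
Proof. by move=> /eqP cA; exists (Sub A cA); rewrite /vset SubK. Qed.

Lemma vertex_swap z a b : a \notin vset z -> b \in vset z ->
  exists u : X, vset u = swap (vset z) a b.
Proof. by move=> az bz; apply: vertex_of; rewrite card_swap ?card_vertex. Qed.

(** The common neighbour is unique: the union of y and z has m + 1 points, so
its complement is the only vertex disjoint from both. *)
Lemma adj_vertex_compl y z : (#|vset y :&: vset z|.+1 = m)%N ->
  exists v : X, [/\ vset v = ~: (vset y :|: vset z), adj y v & adj v z].
Proof.
move=> yz; have [|v ev] := @vertex_of (~: (vset y :|: vset z)).
  have := cardsC (vset y :|: vset z); have := cardsUI (vset y) (vset z).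
  by rewrite card_T !card_vertex; lia.
exists v; rewrite /odd_adj -!/(vset _) ev -![[disjoint _ & _]]setI_eq0.
split=> //; first by rewrite setCU setIA setICr set0I.
by rewrite setCU -setIA (setIC (~: vset z)) setICr setI0.
Qed.

Lemma neq_vertex_swap y z : y != z -> exists a b,
  [/\ a \in vset y, a \notin vset z, b \in vset z & b \notin vset y].
Proof.
move=> neq_yz.
have sub u v : vset u \subset vset v -> u = v.
  move=> suv; apply/vset_inj/eqP.
  by rewrite eqEcard suv !card_vertex leqnn.
have /subsetPn[a ay az] : ~~ (vset y \subset vset z).
  by apply: contra neq_yz => /sub ->.
have /subsetPn[b bz b_y] : ~~ (vset z \subset vset y).
  by apply: contra neq_yz => /sub ->.
by exists a, b.
Qed.

Lemma overlapT y z : overlap [set: T] (vset y) (vset z) = #|vset y :&: vset z|.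
Proof. by rewrite /overlap setTI. Qed.

Lemma overlapTid y : overlap [set: T] (vset y) (vset y) = m.
Proof. by rewrite overlapT setIid card_vertex. Qed.

(** Two steps change at most one point of a vertex, and a single step turns a
large intersection into a small one and conversely. *)
Lemma walk_meet n p y k : path adj y p -> size p = n ->
  (n = 2 * k -> m <= k + #|vset y :&: vset (last y p)|)%N /\
  (n = (2 * k).+1 -> #|vset y :&: vset (last y p)| <= k)%N.
Proof.
elim: p n y k => [|u p IHp] [|n] y k //.
  by rewrite /= setIid card_vertex; split; lia.
rewrite [last _ _]/= => /andP[yu /IHp{}IHp] [/IHp{}IHp]; set z := last u p.
have yu0 : overlap [set: T] (vset y) (vset u) = 0 by exact: overlap_disjoint.
have := overlap_cover [set: T] (vset y) (vset u) (vset z).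
have := overlap_triangle [set: T] (vset y) (vset z) (vset u).
rewrite (overlapC _ (vset z) (vset u)) !overlapTid yu0 cardsT card_T !overlapT.
have [IH0 _] := IHp k; have [_ IH1] := IHp k.-1; rewrite -/z in IH0 IH1.
by move=> Htri Hcov; split; lia.
Qed.

(** Each exchange of a point costs two steps, through the common neighbour. *)
Lemma even_walk y z k : (#|vset y :&: vset z| + k = m)%N -> has_walk adj (2 * k) y z.
Proof.
elim: k z => [|k IHk] z yz.
  apply/has_walkP; exists [::]; split=> //=; apply/vset_inj/eqP.
  by rewrite eqEcard !card_vertex leqnn andbT; apply/setIidPl/eqP;
     rewrite eqEcard subsetIl card_vertex; lia.
have [e|neq_yz] := eqVneq y z.
  by move: yz; rewrite e setIid card_vertex; lia.
have [a [b [ay az bz b_y]]] := neq_vertex_swap neq_yz.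
have [u eu] := vertex_swap az bz.
have := overlap_swapl [set: T] ay az b_y.
have := overlap_swapr [set: T] az bz.
rewrite -eu !overlapT setIid card_vertex !inE => uz yu.
have [|v [_ uv vz]] := @adj_vertex_compl u z; first by lia.
rewrite mulnS; apply: has_walk_rcons vz; apply: has_walk_rcons uv.
by apply: IHk; lia.
Qed.

(** An even walk reaches a neighbour v of z that contains y :\: z; the last step
leads to z. *)
Lemma odd_walk y z k : (#|vset y :&: vset z| = k)%N ->
  has_walk adj (2 * k).+1 y z.
Proof.
move=> yz.
have cyUz : #|vset y :|: vset z| + k = 2 * m.
  by rewrite -yz cardsUI !card_vertex; lia.
have /card_gt0P[t] : (0 < #|~: (vset y :|: vset z)|)%N.
  by have := cardsC (vset y :|: vset z); rewrite card_T; lia.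
rewrite !inE negb_or => /andP[ty tz].
(* The complement of z has m + 1 points; removing t leaves the wanted vertex. *)
have [|v ev] := @vertex_of (~: vset z :\ t).
  have := cardsD1 t (~: vset z); have := cardsC (vset z).
  by rewrite inE tz card_T card_vertex; lia.
have vz : adj v z.
  rewrite /odd_adj -!/(vset _) ev -setI_eq0 setDE setIAC.
  by rewrite (setIC (~: _)) setICr set0I.
apply: has_walk_rcons vz; apply: even_walk.
have -> : vset y :&: vset v = vset y :\: vset z.
  rewrite ev; apply/setP=> s; rewrite !inE.
  have [->|] := eqVneq s t; first by rewrite (negPf ty) andbF.
  by rewrite andbC.
by have := cardsID (vset z) (vset y); rewrite card_vertex yz; lia.
Qed.

(** The distance function searches walks of length less than the number of
vertices; this bound puts the radii of all spheres within that range. *)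
Lemma card_odd_vertex_gt : (m < #|X|)%N.
Proof.
have -> : #|X| = 'C((2 * m).+1, m).
  by rewrite card_sig -card_T -card_draws cardsE.
have bin_ge p q : (0 < p -> q < 'C(p + q, p))%N.
  case: p => // p _; elim: q => [|q IHq]; first by rewrite addn0 binn.
  rewrite addnS binS; apply: leq_ltn_trans IHq _.
  by rewrite -[X in (X < _)%N]addn0 ltn_add2l bin_gt0; lia.
case: m => [|p]; first by rewrite bin0.
have -> : (2 * p.+1).+1 = p.+1 + p.+2 by lia.
by apply: ltn_trans (bin_ge _ _ _).
Qed.

Lemma gdist_odd y z : gdist adj y z = radius m (m - #|vset y :&: vset z|).
Proof.
have le_yz : (#|vset y :&: vset z| <= m)%N.
  have := subset_leq_card (subsetIl (vset y) (vset z)).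
  by rewrite card_vertex.
have card_gt := card_odd_vertex_gt.
apply: gdist_least; first by rewrite /radius; case: ifP; lia.
  rewrite /radius; case: ifP => _; first by apply: even_walk; lia.
  by apply: odd_walk; lia.
move=> k' ltk'; apply/negP => /has_walkP[p [sp yp lp]].
have [H0 H1] := walk_meet k'./2 yp sp; rewrite lp in H0 H1.
move: H0 H1 ltk'; rewrite /radius.
have := odd_double_half k'; case: (odd k'); case: ifP; lia.
Qed.

End OddGraph.

(** * Orbits of pairs of vertices under the stabiliser of x *)

Lemma radius_inj m i j : (i <= m)%N -> (j <= m)%N -> radius m i = radius m j -> i = j.
Proof. by rewrite /radius; case: ifP; case: ifP; lia. Qed.

Lemma radius_le m i : (i <= m)%N -> (radius m i <= m)%N.
Proof. by rewrite /radius; case: ifP; lia. Qed.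

Lemma LH_indices_uniq m : uniq (LH_indices m).
Proof.
apply: allpairs_uniq_dep => [|ij _|[a b] [c d] _ _ /= [-> ->]] //.
  by apply: allpairs_uniq; rewrite ?iota_uniq // => -[a b] [c d] _ _ [-> ->].
by apply: allpairs_uniq; rewrite ?filter_uniq ?iota_uniq // => -[a b] [c d] _ _ [-> ->].
Qed.

Lemma LH_indicesP m w : w \in LH_indices m ->
  [/\ w.1.1 <= m, w.1.2 <= m, w.2.1 \in Grange (m - w.1.1) (m - w.1.2) m
    & w.2.2 \in Grange w.1.1 w.1.2 m.+1]%N.
Proof.
case/allpairsPdep => ij [ls [/allpairsP[[i j] []]]].
rewrite !mem_iota => ilt jlt ->.
by case/allpairsP => [[l s] /= [lG sG ->]] ->.
Qed.

Section Orbitals.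

Variables (T : finType) (m : nat).
Local Notation X := (odd_vertex T m).
Local Notation adj := (@odd_adj T m).
Variable x : X.
Implicit Types y z u v : X.

Definition inner y z := overlap (vset x) (vset y) (vset z).
Definition outer y z := overlap (~: vset x) (vset y) (vset z).

Definition pair_type y z := ((outer y y, outer z z), (inner y z, outer y z)).

Lemma inner_outer y z : (inner y z + outer y z = #|vset y :&: vset z|)%N.
Proof. exact: overlap_split. Qed.

Lemma inner_outer_id y : (inner y y + outer y y = m)%N.
Proof. by rewrite inner_outer setIid card_vertex. Qed.

Lemma innerC y z : inner y z = inner z y. Proof. exact: overlapC. Qed.
Lemma outerC y z : outer y z = outer z y. Proof. exact: overlapC. Qed.

Lemma inner_le y z : (inner y z <= inner y y)%N. Proof. exact: overlap_le. Qed.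
Lemma outer_le y z : (outer y z <= outer y y)%N. Proof. exact: overlap_le. Qed.

Lemma inner_triangle y u z :
  (inner y u + inner u z <= inner u u + inner y z)%N.
Proof. exact: overlap_triangle. Qed.
Lemma outer_triangle y u z :
  (outer y u + outer u z <= outer u u + outer y z)%N.
Proof. exact: overlap_triangle. Qed.

Lemma inner_cover y u z :
  (inner y y + inner u u + inner z z <=
   m + (inner y u + inner u z + inner y z))%N.
Proof.
by have := overlap_cover (vset x) (vset y) (vset u) (vset z); rewrite card_vertex.
Qed.

Lemma adj_inner y z : adj y z -> inner y z = 0%N.
Proof. exact: overlap_disjoint. Qed.
Lemma adj_outer y z : adj y z -> outer y z = 0%N.
Proof. exact: overlap_disjoint. Qed.

Lemma vertex_eqE y z : (y == z) = (inner y z + outer y z == m)%N.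
Proof.
rewrite inner_outer; apply/eqP/eqP => [->|yz]; first by rewrite setIid card_vertex.
apply/vset_inj/eqP; rewrite eqEcard !card_vertex leqnn andbT.
by apply/setIidPl/eqP; rewrite eqEcard subsetIl card_vertex yz leqnn.
Qed.

Lemma adjE y z : adj y z = (inner y z + outer y z == 0)%N.
Proof. by rewrite inner_outer cards_eq0 setI_eq0. Qed.

Lemma outer_id_le y : (outer y y <= m)%N.
Proof. by have := inner_outer_id y; lia. Qed.

(** The permutation of the ground set that matches the Venn diagrams of
x, y, z and x, y', z' acts on vertices and preserves all types. *)
Lemma pair_type_transitive y z y' z' : pair_type y z = pair_type y' z' ->
  exists f : X -> X, [/\ injective f, f y = y', f z = z' &
    forall u v, pair_type (f u) (f v) = pair_type u v].
Proof.
case=> oy oz iyz oyz.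
have iy : inner y y = inner y' y'.
  by have := inner_outer_id y; have := inner_outer_id y'; lia.
have iz : inner z z = inner z' z'.
  by have := inner_outer_id z; have := inner_outer_id z'; lia.
have [|p p_inj pE] :=
    @same_overlaps_perm T (vset x) (vset y) (vset z) (vset y') (vset z').
  by move=> S [] ->.
have card_p u : #|p @: vset u| == m by rewrite card_imset // card_vertex.
pose f u : X := Sub (p @: vset u) (card_p u).
have fE u : vset (f u) = p @: vset u by rewrite /vset SubK.
exists f; split.
- move=> u v /(congr1 (@vset _ _)); rewrite !fE.
  by move/(imset_inj p_inj)/vset_inj.
- apply: vset_inj; rewrite fE; apply: imset_preim_eq; rewrite ?card_vertex // => t.
  by case: (pE t).
- apply: vset_inj; rewrite fE; apply: imset_preim_eq; rewrite ?card_vertex // => t.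
  by case: (pE t).
have px t : (p t \in vset x) = (t \in vset x) by case: (pE t).
have pCx t : (p t \in ~: vset x) = (t \in ~: vset x) by rewrite !inE px.
move=> u v; rewrite /pair_type /inner /outer !fE.
by rewrite !(overlap_imset _ _ p_inj px) !(overlap_imset _ _ p_inj pCx).
Qed.

Hypothesis card_T : #|T| = (2 * m).+1.

Lemma card_outside : #|~: vset x| = m.+1.
Proof. by have := cardsC (vset x); rewrite card_T card_vertex; lia. Qed.

Lemma outer_cover y u z :
  (outer y y + outer u u + outer z z <=
   m.+1 + (outer y u + outer u z + outer y z))%N.
Proof. by rewrite -card_outside; apply: overlap_cover. Qed.

Lemma gdist_base y : gdist adj x y = radius m (outer y y).
Proof.
rewrite (gdist_odd card_T); congr radius.
by have := inner_outer_id y; rewrite /inner /overlap setIid; lia.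
Qed.

Lemma pair_type_LH_indices y z : pair_type y z \in LH_indices m.
Proof.
have le k : (k < m.+1)%N -> k \in iota 0 m.+1 by rewrite mem_iota.
have mem_G i j n l : (l <= minn i j)%N -> (i + j <= n + l)%N -> l \in Grange i j n.
  by move=> l1 l2; rewrite mem_filter mem_iota; lia.
have := inner_outer_id y; have := inner_outer_id z.
have := inner_le y z; have := inner_le z y; rewrite (innerC z y).
have := outer_le y z; have := outer_le z y; rewrite (outerC z y).
have := overlap_compl (vset x) (vset y) (vset z).
have := overlap_compl (~: vset x) (vset y) (vset z).
rewrite card_outside card_vertex -!/(inner _ _) -!/(outer _ _).
move=> *; apply: allpairs_f_dep; first by apply: allpairs_f; apply: le; lia.
by apply: allpairs_f; apply: mem_G => /=; lia.
Qed.

Lemma pair_type_onto w : w \in LH_indices m -> exists y z, pair_type y z = w.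
Proof.
case: w => -[i j] [l s] /LH_indicesP[/= lei lej Gl Gs].
rewrite -(card_vertex x) in Gl; rewrite -card_outside in Gs.
have [A [C [sA sC cA cC cAC]]] := subsets_meeting Gl.
have [B [D [sB sD cB cD cBD]]] := subsets_meeting Gs.
have glue (P Q : {set T}) k : P \subset vset x -> Q \subset ~: vset x ->
   #|P| = (#|vset x| - k)%N -> #|Q| = k -> (k <= m)%N -> exists2 u : X,
     vset x :&: vset u = P & ~: vset x :&: vset u = Q.
  move=> sP sQ cP cQ lek; rewrite card_vertex in cP.
  have xQ : vset x :&: Q = set0.
    by apply/eqP; rewrite setI_eq0 disjoint_sym disjoints_subset.
  have xP : ~: vset x :&: P = set0.
    by apply/eqP; rewrite setI_eq0 disjoint_sym disjoints_subset setCK.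
  have [|u eu] := @vertex_of T m (P :|: Q).
    have := cardsUI P Q; suff -> : P :&: Q = set0 by rewrite cards0; lia.
    by apply/eqP; rewrite -subset0 -xQ setSI.
  exists u; rewrite eu setIUr; first by rewrite xQ setU0 (setIidPr sP).
  by rewrite xP set0U (setIidPr sQ).
have [y yA yB] := glue A B i sA sB cA cB lei.
have [z zC zD] := glue C D j sC sD cC cD lej.
exists y, z; rewrite /pair_type /inner /outer /overlap !setIid.
rewrite (setIIr (vset x) (vset y)) (setIIr (~: vset x) (vset y)).
by rewrite yA yB zC zD cB cD cAC cBD.
Qed.

End Orbitals.

(** * The algebra spanned by the orbit matrices *)

Section Matrices.

Variables (F : numFieldType) (T : finType) (m : nat).
Hypothesis card_T : #|T| = (2 * m).+1.
Local Notation X := (odd_vertex T m).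
Local Notation adj := (@odd_adj T m).
Variable x : X.
Implicit Types (y z u v : X) (M N : 'Mat[F]_X) (r : rel X).

Local Open Scope ring_scope.
Local Notation outer := (outer x).
Local Notation inner := (inner x).
Local Notation pair_type := (pair_type x).

(** Entries read at vertices rather than at their indices. *)
Definition entry M y z : F := M (vidx x y) (vidx x z).

Definition relmx r : 'Mat[F]_X :=
  \matrix_(a, b) (r (vval x a) (vval x b))%:R.

Definition orbital_mx w := relmx (fun y z => pair_type y z == w).

Lemma entry_ext M N : (forall y z, entry M y z = entry N y z) -> M = N.
Proof.
move=> eqMN; apply/matrixP => a b.
by have := eqMN (vval x a) (vval x b); rewrite /entry !vvalK.
Qed.

Lemma entry_relmx r y z : entry (relmx r) y z = (r y z)%:R.
Proof. by rewrite /entry mxE !vidxK. Qed.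

Lemma entryM M N y z : entry (M * N) y z = \sum_u entry M y u * entry N u z.
Proof.
rewrite /entry -[M * N]/(M *m N) mxE (reindex (vidx x)) //.
by exists (vval x) => u _; rewrite (vidxK, vvalK).
Qed.

Lemma entry_relmxM r1 r2 y z :
  entry (relmx r1 * relmx r2) y z = #|[set u | r1 y u && r2 u z]|%:R.
Proof.
rewrite entryM card_indicator natr_sum; apply: eq_bigr => u _.
by rewrite !entry_relmx inE -natrM mulnb.
Qed.

Lemma entry_sum (I : Type) (s : seq I) (c : I -> F) (A : I -> 'Mat[F]_X) y z :
  entry (\sum_(i <- s) c i *: A i) y z = \sum_(i <- s) c i * entry (A i) y z.
Proof. by rewrite /entry summxE; apply: eq_bigr => i _; rewrite mxE. Qed.

Definition invariant M := forall y z y' z',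
  pair_type y z = pair_type y' z' -> entry M y z = entry M y' z'.

(** An automorphism that carries (y, z) to (y', z') permutes the middle
vertices of the sum that defines the product. *)
Lemma invariantM M N : invariant M -> invariant N -> invariant (M * N).
Proof.
move=> invM invN y z y' z' /pair_type_transitive[f [f_inj <- <- fE]].
rewrite !entryM [RHS](reindex_inj f_inj); apply: eq_bigr => u _.
by rewrite (invM y u (f y) (f u)) ?fE // (invN u z (f u) (f z)) ?fE.
Qed.

Lemma invariant_relmx r :
    (forall y z y' z', pair_type y z = pair_type y' z' -> r y z = r y' z') ->
  invariant (relmx r).
Proof. by move=> inv_r y z y' z' /inv_r e; rewrite !entry_relmx e. Qed.

Lemma invariant_orbital w : invariant (orbital_mx w).
Proof. by apply: invariant_relmx => y z y' z' ->. Qed.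

(** The common value of M on the pairs of type w, read off at some such pair;
0 for a type that no pair has. *)
Definition orbital_coef M w : F :=
  if [pick yz | pair_type yz.1 yz.2 == w] is Some yz then entry M yz.1 yz.2
  else 0.

Lemma orbital_coefE M y z : invariant M ->
  orbital_coef M (pair_type y z) = entry M y z.
Proof.
move=> invM; rewrite /orbital_coef; case: pickP => [yz /eqP /invM //|].
by move/(_ (y, z)); rewrite eqxx.
Qed.

Lemma sum_orbitalE (c : nat * nat * (nat * nat) -> F) y z :
  entry (\sum_(w <- LH_indices m) c w *: orbital_mx w) y z = c (pair_type y z).
Proof.
rewrite entry_sum (bigD1_seq (pair_type y z)) ?LH_indices_uniq //=; last first.
  exact: pair_type_LH_indices.
rewrite entry_relmx eqxx mulr1 big1 ?addr0 // => w neq_w.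
by rewrite entry_relmx eq_sym (negPf neq_w) mulr0.
Qed.

Lemma invariant_expand M : invariant M ->
  M = \sum_(w <- LH_indices m) orbital_coef M w *: orbital_mx w.
Proof.
by move=> invM; apply: entry_ext => y z; rewrite sum_orbitalE orbital_coefE.
Qed.

Local Notation orbital_space := <<[seq orbital_mx w | w <- LH_indices m]>>%VS.

Lemma orbital_spaceP M : reflect (invariant M) (M \in orbital_space).
Proof.
apply: (iffP idP) => [|invM]; last first.
  rewrite (invariant_expand invM) big_seq; apply: memv_suml => w w_in.
  by apply/memvZ/memv_span/map_f.
set s := [seq _ | _ <- _]; move/(@coord_span _ _ _ (in_tuple s)) => ->.
move=> y z y' z' e; rewrite !entry_sum; apply: eq_bigr => i _.
congr (_ * _); rewrite (nth_map ((0, 0), (0, 0))%N).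
  exact: invariant_orbital e.
by rewrite -(size_map orbital_mx) ltn_ord.
Qed.

Lemma orbital_free : free [seq orbital_mx w | w <- LH_indices m].
Proof.
set s := [seq _ | _ <- _]; apply/(@freeP _ _ _ (in_tuple s)) => k sum0 i.
have szs : size s = size (LH_indices m) by rewrite size_map.
pose w0 : nat * nat * (nat * nat) := ((0, 0), (0, 0))%N.
pose w_ (j : 'I_(size s)) := nth w0 (LH_indices m) j.
have lt_j (j : 'I_(size s)) : (j < size (LH_indices m))%N by rewrite -szs.
have [y [z yz]] : exists y z, pair_type y z = w_ i.
  by apply: pair_type_onto => //; apply: mem_nth.
have := congr1 (fun M => entry M y z) sum0.
rewrite entry_sum (bigD1 i) //= (nth_map w0) // entry_relmx yz eqxx mulr1.
rewrite big1 ?addr0 => [->|j neq_j]; first by rewrite /entry mxE.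
rewrite (nth_map w0) // entry_relmx yz [_ == _](_ : _ = false) ?mulr0 //.
apply: contraNF neq_j; rewrite nth_uniq ?LH_indices_uniq // => /eqP e_ij.
exact/eqP/esym/val_inj.
Qed.

Local Notation terw := (terwilliger F adj m x).

Lemma adj_mx_relmx : adj_mx F adj x = relmx adj.
Proof. by []. Qed.

Lemma entry_dual_idempotent k y z :
  entry (dual_idempotent F adj x k) y z
  = ((y == z) && (radius m (outer y y) == k))%:R.
Proof.
rewrite /entry mxE !vidxK inE gdist_base //.
by rewrite (can_eq (@vidxK _ x)).
Qed.

Lemma adj_terw : relmx adj \in terw.
Proof. by apply: (subvP (sub_agenv _)); apply/memv_span; rewrite mem_head. Qed.

Lemma dual_idempotent_terw k : (k <= m)%N -> dual_idempotent F adj x k \in terw.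
Proof.
move=> lekm; apply: (subvP (sub_agenv _)); apply/memv_span.
by rewrite inE map_f ?orbT // mem_iota.
Qed.

(** The generators are invariant, since adjacency and the distance to x can be
read on the type. *)
Lemma terw_sub_orbital : (terw <= orbital_space)%VS.
Proof.
have dual_inv k : invariant (dual_idempotent F adj x k).
  move=> y z y' z' e; rewrite !entry_dual_idempotent !(vertex_eqE x).
  by case: e => -> _ -> ->.
apply: agenv_sub_modl.
  apply/subvP => _ /vlineP[c ->]; apply/memvZ/orbital_spaceP => y z y' z' e.
  rewrite /entry !mxE !(can_eq (@vidxK _ x)) !(vertex_eqE x).
  by case: e => _ _ -> ->.
apply/prodvP => M N MG /orbital_spaceP invN; apply/orbital_spaceP.
apply: invariantM => //; apply/orbital_spaceP; apply: subvP MG.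
apply/span_subvP => A; rewrite inE => /predU1P[->|/mapP[k _ ->]].
  apply/orbital_spaceP; rewrite adj_mx_relmx; apply: invariant_relmx.
  by move=> y z y' z' e; rewrite !(adjE x); case: e => _ _ -> ->.
exact/orbital_spaceP.
Qed.

Lemma terw_invariant M : M \in terw -> invariant M.
Proof. by move/(subvP terw_sub_orbital)/orbital_spaceP. Qed.

Lemma terwM M N : M \in terw -> N \in terw -> M * N \in terw.
Proof. exact: (@memvM _ _ (agenv_aspace _)). Qed.

(** The orbit expansion of the product of the two matrices involves the orbit of
(y, z), by the path through u, and otherwise only orbits already in the
algebra; solve for the orbit matrix of (y, z). *)
Lemma orbital_of_product r1 r2 y u z :
    relmx r1 \in terw -> relmx r2 \in terw -> r1 y u -> r2 u z ->
    (forall y' u' z', r1 y' u' -> r2 u' z' ->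
       pair_type y' z' = pair_type y z \/ orbital_mx (pair_type y' z') \in terw) ->
  orbital_mx (pair_type y z) \in terw.
Proof.
move=> Tr1 Tr2 yu uz others; pose P := relmx r1 * relmx r2.
have TP : P \in terw by exact: terwM.
have invP := terw_invariant TP.
have c0 : orbital_coef P (pair_type y z) != 0.
  rewrite orbital_coefE // entry_relmxM pnatr_eq0 -lt0n card_gt0.
  by apply/set0Pn; exists u; rewrite inE yu uz.
rewrite -[orbital_mx _](scalerK c0) memvZ //.
have := invariant_expand invP.
rewrite (bigD1_seq (pair_type y z)) ?LH_indices_uniq ?pair_type_LH_indices //=.
move/(canLR (addrK _)) => <-; rewrite rpredB //.
rewrite big_seq_cond; apply: memv_suml => w /andP[w_in neq_w].
have [y' [z' e]] := pair_type_onto x card_T w_in.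
have [->|] := eqVneq (orbital_coef P w) 0; first by rewrite scale0r mem0v.
rewrite -e orbital_coefE // entry_relmxM pnatr_eq0 -lt0n card_gt0.
case/set0Pn => u'; rewrite inE => /andP[yu' uz'].
have [e'|Tw] := others _ _ _ yu' uz'; last exact: memvZ.
by rewrite -e e' eqxx in neq_w.
Qed.

(** The type of (y, y) forces equal vertices on the sphere of y, so this orbit
matrix is a dual idempotent. *)
Lemma orbital_diag y : orbital_mx (pair_type y y) \in terw.
Proof.
suff -> : orbital_mx (pair_type y y)
    = dual_idempotent F adj x (radius m (outer y y)).
  by apply/dual_idempotent_terw/radius_le/outer_id_le.
apply: entry_ext => u v; rewrite entry_relmx entry_dual_idempotent.
congr (_%:R); congr nat_of_bool.
apply/eqP/andP => [[eo _ iu ou]|[/eqP <- /eqP/radius_inj e]].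
  by rewrite (vertex_eqE x) iu ou inner_outer_id eo !eqxx.
have eo : outer u u = outer y y by apply: e; apply: outer_id_le.
have ei : inner u u = inner y y.
  by have := inner_outer_id x u; have := inner_outer_id x y; lia.
congr (_, _, (_, _)) => //.
Qed.

Lemma adj_block_terw i k : (i <= m)%N -> (k <= m)%N ->
  relmx (fun y u => [&& outer y y == i, adj y u & outer u u == k]) \in terw.
Proof.
move=> leim lekm.
set B := relmx _; pose E j := dual_idempotent F adj x (radius m j).
suff -> : B = E i * relmx adj * E k.
  by rewrite !terwM ?adj_terw ?dual_idempotent_terw ?radius_le.
apply: entry_ext => y z; rewrite entry_relmx entryM.
have radE j u : (j <= m)%N -> (radius m (outer u u) == radius m j) = (outer u u == j).
  move=> lejm; apply/eqP/eqP => [|-> //]; apply: radius_inj => //.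
  exact: outer_id_le.
rewrite (bigD1 z) //= big1 ?addr0 => [|u neq_u]; last first.
  by rewrite [X in _ * X]entry_dual_idempotent (negPf neq_u) mulr0.
rewrite entry_dual_idempotent eqxx radE // entryM (bigD1 y) //=.
rewrite big1 ?addr0 => [|u neq_u]; last first.
  by rewrite entry_dual_idempotent eq_sym (negPf neq_u) mul0r.
by rewrite entry_dual_idempotent eqxx radE // entry_relmx -!natrM !mulnb andbA.
Qed.

(** For the vertex v complementary to y :|: z, inclusion-exclusion is an
equality in x and in its complement. The ends of any other path between the same
spheres overlap at least as much in both parts, so they have the type of (y, z)
or m points in common. *)
Lemma orbital_edge y z : (#|vset y :&: vset z|.+1 = m)%N ->
  orbital_mx (pair_type y z) \in terw.
Proof.
move=> yz; have [v [ev yv vz]] := adj_vertex_compl card_T yz.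
apply: (@orbital_of_product _ _ y v z
  (adj_block_terw (outer_id_le x y) (outer_id_le x v))
  (adj_block_terw (outer_id_le x v) (outer_id_le x z))).
- by rewrite !eqxx yv.
- by rewrite !eqxx vz.
move=> y' v' z' /and3P[/eqP oy yv' /eqP ov] /and3P[_ vz' /eqP oz].
have := overlap_compl (vset x) (vset y) (vset z).
have := overlap_compl (~: vset x) (vset y) (vset z).
rewrite -ev (card_outside x card_T) card_vertex -!/(inner _ _) -!/(outer _ _).
have := inner_cover x y' v' z'; have := outer_cover x card_T y' v' z'.
rewrite (adj_inner x yv') (adj_inner x vz') (adj_outer x yv') (adj_outer x vz').
have := inner_outer_id x y; have := inner_outer_id x y'.
have := inner_outer_id x z; have := inner_outer_id x z'.
have := inner_outer_id x v; have := inner_outer_id x v'.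
have := inner_outer x y z.
have := outer_le x y' z'; have := inner_le x y' z'.
rewrite -/(outer _ _).
have [<- *|] := eqVneq y' z'; first by right; apply: orbital_diag.
rewrite (vertex_eqE x) => /eqP *; left.
by congr (_, _, (_, _)); lia.
Qed.

(** The exchange that produces u is chosen so that the triangle inequality for
(y, u, z) is an equality both in x and in its complement. *)
Lemma orbital_in_terw y z : orbital_mx (pair_type y z) \in terw.
Proof.
have [n] := ubnP (m - #|vset y :&: vset z|); elim: n y z => // n IHn y z lt_n.
have [->|neq_yz] := eqVneq y z; first exact: orbital_diag.
have [a [b [ay az bz b_y]]] := neq_vertex_swap neq_yz.
have [u eu] := vertex_swap az bz.
have swl S := overlap_swapl S ay az b_y; have swr S := overlap_swapr S az bz.
have sw S := overlap_swap S az bz.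
rewrite -!eu in swl swr sw.
have le_m (v w : X) : (#|vset v :&: vset w| <= m)%N.
  by have := subset_leq_card (subsetIl (vset v) (vset w)); rewrite card_vertex.
have yuT : #|vset y :&: vset u| = #|vset y :&: vset z|.+1.
  by have := swl setT; rewrite !overlapT inE addn1.
have uzT : (#|vset u :&: vset z|.+1 = m)%N.
  by have := swr setT; rewrite overlapTid overlapT inE addn1.
apply: (@orbital_of_product (fun y' u' => pair_type y' u' == pair_type y u)
  (fun u' z' => pair_type u' z' == pair_type u z) y u z) => //.
- by apply: IHn; have := le_m y u; lia.
- exact: orbital_edge.
move=> y' u' z' /eqP[oy ou iyu oyu] /eqP[_ oz iuz ouz].
have := swl (vset x); have := swl (~: vset x).
have := swr (vset x); have := swr (~: vset x).
have := sw (vset x); have := sw (~: vset x).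
rewrite -!/(inner _ _) -!/(outer _ _).
have := inner_triangle x y' u' z'; have := outer_triangle x y' u' z'.
have := inner_outer_id x u; have := inner_outer_id x u'.
have := inner_outer x y z; have := inner_outer x y' z' => yz' yz.
have [e *|neq *] := eqVneq (pair_type y' z') (pair_type y z); first by left.
right; apply: IHn; have := le_m y' z'; have := le_m y z.
suff: (#|vset y :&: vset z| < #|vset y' :&: vset z'|)%N by lia.
rewrite ltnNge; apply/negP => le_yz; case/eqP: neq.
by congr (_, _, (_, _)); lia.
Qed.

Lemma orbital_basis :
  basis_of terw [seq orbital_mx w | w <- LH_indices m].
Proof.
rewrite /basis_of orbital_free andbT eqEsubv terw_sub_orbital andbT.
apply/span_subvP => _ /mapP[w w_in ->].
by have [y [z <-]] := pair_type_onto x card_T w_in; apply: orbital_in_terw.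
Qed.

End Matrices.

(** * The blocks as orbit matrices *)

Section Blocks.

(** A set splits in one way along V and its complement, so that the sums which
relabel the Kronecker product have a single term. *)
Lemma pair_union_unique (T : finType) (V A : {set T}) k l :
    #|V :&: A| = k -> #|~: V :&: A| = l ->
  exists p : 'I_#|ksubsets V k|, exists q : 'I_#|ksubsets (~: V) l|,
    [/\ enum_val p = V :&: A, enum_val q = ~: V :&: A &
      forall r, (pair_union r == A) = (r == mxtens_index (p, q))].
Proof.
move=> cV cW.
have inV : V :&: A \in ksubsets V k by rewrite inE subsetIl cV eqxx.
have inW : ~: V :&: A \in ksubsets (~: V) l by rewrite inE subsetIl cW eqxx.
exists (enum_rank_in inV (V :&: A)), (enum_rank_in inW (~: V :&: A)).
rewrite !enum_rankK_in //; split=> // r; rewrite /pair_union.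
case: (mxtens_indexP r) => p q; rewrite mxtens_indexK /=.
rewrite (can_eq (@mxtens_indexK _ _)) xpair_eqE -!(inj_eq enum_val_inj).
rewrite !enum_rankK_in //.
have /setIdP[sp _] := enum_valP p; have /setIdP[sq _] := enum_valP q.
apply/eqP/andP => [<-|[/eqP -> /eqP ->]]; last first.
  by rewrite -setIUl setUCr setTI.
rewrite !setIUr (setIidPr sp) (setIidPr sq); split; apply/eqP.
  suff -> : V :&: enum_val q = set0 by rewrite setU0.
  by apply/eqP; rewrite setI_eq0 disjoint_sym disjoints_subset.
suff -> : ~: V :&: enum_val p = set0 by rewrite set0U.
by apply/eqP; rewrite setI_eq0 disjoint_sym disjoints_subset setCK.
Qed.

Variables (F : numFieldType) (T : finType) (m : nat).
Hypothesis card_T : #|T| = (2 * m).+1.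
Local Notation X := (odd_vertex T m).
Local Notation adj := (@odd_adj T m).
Variable x : X.
Implicit Types y z : X.

Local Open Scope ring_scope.

Lemma entry_embed_block p q
    (M : 'M[F]_(#|sphere adj p x|, #|sphere adj q x|)) (g : X -> X -> F) :
    (forall a b, M a b = g (enum_val a) (enum_val b)) ->
  forall y z, entry x (embed_block M) y z
    = if (y \in sphere adj p x) && (z \in sphere adj q x) then g y z else 0.
Proof.
move=> gE y z; rewrite /entry /embed_block summxE.
pose d u v : F := g u v * ((y == u) && (z == v))%:R.
transitivity (\sum_(u in sphere adj p x) \sum_(v in sphere adj q x) d u v).
  rewrite [RHS]big_enum_val; apply: eq_bigr => a _.
  rewrite [RHS]big_enum_val summxE; apply: eq_bigr => b _.
  by rewrite !mxE gE !(can_eq (@vidxK _ x)).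
case: ifP => [/andP[yp zq]|out].
  rewrite (bigD1 y) //= (bigD1 z) //= /d !eqxx mulr1.
  rewrite !big1 ?addr0 // => [u /andP[_ nu]|v /andP[_ nv]].
    by rewrite big1 // => v _; rewrite eq_sym (negPf nu) mulr0.
  by rewrite (eq_sym z) (negPf nv) mulr0.
rewrite big1 // => u up; rewrite big1 // => v vq; rewrite /d.
have [ey|] := eqVneq y u; last by rewrite mulr0.
have [ez|] := eqVneq z v; last by rewrite mulr0.
by rewrite ey ez up vq in out.
Qed.

Lemma sphere_radius i y : (i <= m)%N ->
  (y \in sphere adj (radius m i) x) = (outer x y y == i).
Proof.
move=> leim; rewrite inE gdist_base //; apply/eqP/eqP => [|-> //].
by apply: radius_inj => //; apply: outer_id_le.
Qed.

Lemma LH_orbital_mx w : w \in LH_indices m ->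
  LH F x w.1.1 w.1.2 w.2.1 w.2.2 = orbital_mx F x w.
Proof.
case: w => -[i j] [l s] /LH_indicesP[/= leim lejm _ _].
rewrite /LH /=; pose g y z : F := ((inner x y z == l) && (outer x y z == s))%:R.
apply: (entry_ext (x := x)) => y z; rewrite (entry_embed_block (g := g)).
  rewrite !sphere_radius // entry_relmx /pair_type !xpair_eqE /g.
  by do 2!case: (_ == _).
move=> a b; rewrite mxE.
have sphereE k (c : 'I_#|sphere adj (radius m k) x|) : (k <= m)%N ->
    #|val x :&: val (enum_val c)| = (m - k)%N
    /\ #|~: val x :&: val (enum_val c)| = k.
  move=> lekm; have := enum_valP c; rewrite sphere_radius // => /eqP.
  have := inner_outer_id x (enum_val c).
  rewrite /inner /outer /overlap !setIid => io oc; split; last exact: oc.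
  by rewrite -[#|_|]/(#|vset x :&: vset (enum_val c)|); lia.
have [/pair_union_unique pa /pa [p [q [ep eq pqE]]]] := sphereE i a leim.
have [/pair_union_unique pb /pb [p' [q' [ep' eq' pqE']]]] := sphereE j b lejm.
rewrite (big_pred1 (mxtens_index (p, q))) //.
rewrite (big_pred1 (mxtens_index (p', q'))) //.
rewrite tensmxE !mxE ep eq ep' eq' -!setIIr -natrM mulnb.
by [].
Qed.

End Blocks.

Theorem proposition3p6 (R : realType) (Omega : finType) (m : nat)
    (m_ge1 : (1 <= m)%N) (card_Omega : #|Omega| = (2 * m).+1)
    (x : odd_vertex Omega m) :
  basis_of (terwilliger (R[i])%C (@odd_adj Omega m) m x)
    [seq LH (R[i])%C x w.1.1 w.1.2 w.2.1 w.2.2 | w <- LH_indices m].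
Proof.
have /eq_in_map -> := LH_orbital_mx (R[i])%C card_Omega x.
exact: orbital_basis.
Qed.
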